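(* Let $Q$ be a finite idempotent left quasigroup. Then the variety $\mathcal{V}(Q)$ generated by $Q$ has a Mal'cev term if and only if $Q$ is superconnected.
   Context: A left quasigroup is an algebra $(Q,*,\backslash)$ with two binary operations satisfying $x*(x\backslash y)\approx y\approx x\backslash(x*y)$; equivalently every left multiplication $L_x\colon y\mapsto x*y$ is a bijection of $Q$. Subalgebras, varieties and terms are with respect to the signature $\{*,\backslash\}$. $Q$ is idempotent if $x*x\approx x$ holds. $\mathrm{LMlt}(Q)=\langle L_a : a\in Q\rangle$. $Q$ is connected if $\mathrm{LMlt}(Q)$ acts transitively on $Q$; $Q$ is superconnected if all its subalgebras are connected. A Mal'cev term is a ternary term $m$ with $m(x,y,y)\approx x\approx m(y,y,x)$. *)

(* Defs.v *)
From HB Require Import structures.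
From mathcomp Require Import all_boot all_fingroup.

Set Implicit Arguments.
Unset Strict Implicit.
Unset Printing Implicit Defensive.

HB.mixin Record isLeftQuasigroup (T : Type) := {
  lmul : T -> T -> T;
  ldiv : T -> T -> T;
  lmulVK : forall x, cancel (ldiv x) (lmul x);
  lmulK : forall x, cancel (lmul x) (ldiv x)
}.

#[short(type="leftQuasigroupType")]
HB.structure Definition LeftQuasigroup := {T of isLeftQuasigroup T}.

#[short(type="finLeftQuasigroupType")]
HB.structure Definition FinLeftQuasigroup :=
  {T of isLeftQuasigroup T & Finite T}.

Definition idempotent_lq (Q : leftQuasigroupType) : Prop :=
  forall x : Q, lmul x x = x.

Inductive lqterm (V : Type) : Type :=
| TVar of V
| TMul of lqterm V & lqterm V
| TDiv of lqterm V & lqterm V.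

Fixpoint eval (A : leftQuasigroupType) (V : Type) (e : V -> A)
    (t : lqterm V) : A :=
  match t with
  | TVar v => e v
  | TMul t1 t2 => lmul (eval e t1) (eval e t2)
  | TDiv t1 t2 => ldiv (eval e t1) (eval e t2)
  end.

Definition identity : Type := (lqterm nat * lqterm nat)%type.

Definition satisfies (A : leftQuasigroupType) (i : identity) : Prop :=
  forall e : nat -> A, eval e i.1 = eval e i.2.

(* Varieties are equational classes.  Restricting to left quasigroups loses
   nothing for varieties generated by a left quasigroup, since the left
   quasigroup axioms are themselves identities in the signature. *)
Definition variety (K : leftQuasigroupType -> Prop) : Prop :=
  exists E : identity -> Prop,
    forall A : leftQuasigroupType,
      K A <-> (forall i : identity, E i -> satisfies A i).

(* The smallest variety containing Q. *)
Definition generated_variety (Q : leftQuasigroupType)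
    (A : leftQuasigroupType) : Prop :=
  forall K : leftQuasigroupType -> Prop, variety K -> K Q -> K A.

Definition eval3 (A : leftQuasigroupType) (m : lqterm 'I_3) (x y z : A) : A :=
  eval (tnth [tuple x; y; z]) m.

Definition has_malcev_term (K : leftQuasigroupType -> Prop) : Prop :=
  exists m : lqterm 'I_3,
    forall A : leftQuasigroupType, K A ->
      forall x y : A, eval3 m x y y = x /\ eval3 m y y x = x.

Definition lperm (Q : finLeftQuasigroupType) (a : Q) : {perm Q} :=
  perm (can_inj (@lmulK Q a)).

Definition LMlt (Q : finLeftQuasigroupType) : {group {perm Q}} :=
  <<[set lperm a | a : Q]>>%G.

Definition connected (Q : finLeftQuasigroupType) : Prop :=
  [transitive LMlt Q, on [set: Q] | 'P].

(* Subalgebras are nonempty, as usual in universal algebra; this matters here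
   because [transitive _, on S | _] is false when S is empty. *)
Record subalgebra (Q : finLeftQuasigroupType) := Subalgebra {
  subalg_set : {set Q};
  subalg_neq0 : subalg_set != set0;
  subalg_mul : forall x y,
    x \in subalg_set -> y \in subalg_set -> lmul x y \in subalg_set;
  subalg_div : forall x y,
    x \in subalg_set -> y \in subalg_set -> ldiv x y \in subalg_set
}.

Section SubalgebraLeftQuasigroup.
Variables (Q : finLeftQuasigroupType) (S : subalgebra Q).

Definition subalg_type : Type := {x : Q | x \in subalg_set S}.

HB.instance Definition _ := Finite.on subalg_type.

Definition subalg_lmul (x y : subalg_type) : subalg_type :=
  exist _ (lmul (val x) (val y)) (subalg_mul (valP x) (valP y)).

Definition subalg_ldiv (x y : subalg_type) : subalg_type :=
  exist _ (ldiv (val x) (val y)) (subalg_div (valP x) (valP y)).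

Lemma subalg_lmulVK x : cancel (subalg_ldiv x) (subalg_lmul x).
Proof. by move=> y; apply: val_inj; rewrite /= lmulVK. Qed.

Lemma subalg_lmulK x : cancel (subalg_lmul x) (subalg_ldiv x).
Proof. by move=> y; apply: val_inj; rewrite /= lmulK. Qed.

HB.instance Definition _ :=
  isLeftQuasigroup.Build subalg_type subalg_lmulVK subalg_lmulK.

End SubalgebraLeftQuasigroup.

Definition superconnected (Q : finLeftQuasigroupType) : Prop :=
  forall S : subalgebra Q, connected (subalg_type S).

(* Main.v *)
Require Import Defs.
From HB Require Import structures.
From mathcomp Require Import all_boot all_fingroup.

(** Every term operation preserves LMlt-orbits in its rightmost variable, since
    left translations do; so a Mal'cev identity with a suitable pair of arguments
    puts any two elements in the same orbit.  Conversely, call a ternary term [p]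
    with [p(y,y,z) = z] a half Mal'cev term.  Connectedness of the subalgebra
    generated by [a, b] produces a half Mal'cev term with [p(a,b,b) = a]: compose
    left translations by binary terms, cancelling each one by a translation by
    [y].  These local solutions are glued together by
    [r(x,y,z) = p(x, q(x,y,y), q(x,y,z))]: it is again half Mal'cev, it keeps
    every identity [q(a,b,b) = a], and it satisfies [r(a,b,b) = a] as soon as
    [p] is chosen for the pair [(a, q(a,b,b))]. *)

Set Implicit Arguments.
Unset Strict Implicit.
Unset Printing Implicit Defensive.

Fixpoint tsubst (V W : Type) (s : V -> lqterm W) (t : lqterm V) : lqterm W :=
  match t with
  | TVar v => s v
  | TMul t1 t2 => TMul (tsubst s t1) (tsubst s t2)
  | TDiv t1 t2 => TDiv (tsubst s t1) (tsubst s t2)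
  end.

Lemma eq_eval (A : leftQuasigroupType) (V : Type) (e1 e2 : V -> A) :
  e1 =1 e2 -> eval e1 =1 eval e2.
Proof. by move=> ee; elim=> //= t -> u ->. Qed.

Lemma eval_tsubst (A : leftQuasigroupType) (V W : Type) (e : W -> A)
    (s : V -> lqterm W) (t : lqterm V) :
  eval e (tsubst s t) = eval (fun v => eval e (s v)) t.
Proof. by elim: t => //= t -> u ->. Qed.

Lemma tnth3_map (T U : Type) (f : T -> U) (x y z : T) (i : 'I_3) :
  f (tnth [tuple x; y; z] i) = tnth [tuple f x; f y; f z] i.
Proof. by case: i => [[|[|[|]]]]. Qed.

Lemma eval_tsubst_tnth (A : leftQuasigroupType) (W : Type) (e : W -> A)
    (m : lqterm 'I_3) (t1 t2 t3 : lqterm W) :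
  eval e (tsubst (tnth [tuple t1; t2; t3]) m)
    = eval3 m (eval e t1) (eval e t2) (eval e t3).
Proof.
by rewrite eval_tsubst; apply: eq_eval => i; rewrite (tnth3_map (eval e)).
Qed.

Lemma eval_idem (A : leftQuasigroupType) (V : Type) (y : A) (t : lqterm V) :
  idempotent_lq A -> eval (fun=> y) t = y.
Proof.
(* Division is idempotent too: cancelling [y] on the left in [lmul y y = y] gives [y = ldiv y y]. *)
by move=> hA; elim: t => //= t -> u ->; rewrite ?hA // -{2}[y]hA lmulK.
Qed.

Lemma eval3_idem (A : leftQuasigroupType) (y : A) (t : lqterm 'I_3) :
  idempotent_lq A -> eval3 t y y y = y.
Proof.
move=> hA; rewrite -[RHS](eval_idem y t hA).
by apply: eq_eval => i; rewrite -(tnth3_map (fun=> y) y y y).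
Qed.

Lemma generated_variety_refl (Q : leftQuasigroupType) : generated_variety Q Q.
Proof. by move=> K _. Qed.

Lemma generated_variety_satisfies (Q A : leftQuasigroupType) (i : identity) :
  generated_variety Q A -> satisfies Q i -> satisfies A i.
Proof.
move=> QA; apply: (QA (fun B => satisfies B i)).
by exists (eq i) => B; split=> [Bi j <- // | ]; apply.
Qed.

(** Each Mal'cev law is an identity, with [TVar 0] and [TVar 1] as its variables, so it passes from
    [Q] to the whole variety. *)
Lemma has_malcev_termP (Q : leftQuasigroupType) :
  has_malcev_term (generated_variety Q) <->
  exists m : lqterm 'I_3,
    forall x y : Q, eval3 m x y y = x /\ eval3 m y y x = x.
Proof.
split=> -[m mP]; exists m; first exact: mP (@generated_variety_refl Q).
move=> A QA x y; pose X := TVar 0; pose Y := TVar 1.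
pose e n := if n is 0 then x else y.
split.
- have := @generated_variety_satisfies Q A
    (tsubst (tnth [tuple X; Y; Y]) m, X) QA.
  move=> /(_ _ e); rewrite /= eval_tsubst_tnth; apply=> f /=.
  by rewrite eval_tsubst_tnth; case: (mP (f 0) (f 1)).
- have := @generated_variety_satisfies Q A
    (tsubst (tnth [tuple Y; Y; X]) m, X) QA.
  move=> /(_ _ e); rewrite /= eval_tsubst_tnth; apply=> f /=.
  by rewrite eval_tsubst_tnth; case: (mP (f 0) (f 1)).
Qed.

Fixpoint rightmost (V : Type) (t : lqterm V) : V :=
  match t with
  | TVar v => v
  | TMul _ t2 => rightmost t2
  | TDiv _ t2 => rightmost t2
  end.

Section Orbits.
Variable Q : finLeftQuasigroupType.
Local Open Scope group_scope.

Lemma lperm_in_LMlt (a : Q) : lperm a \in LMlt Q.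
Proof. by rewrite mem_gen ?imset_f. Qed.

Lemma lmul_orbit (a b : Q) : lmul a b \in orbit 'P (LMlt Q) b.
Proof.
have -> : lmul a b = 'P%act b (lperm a) by rewrite /= /aperm permE.
exact: mem_orbit (lperm_in_LMlt a).
Qed.

Lemma eval_orbit (V : Type) (e : V -> Q) (t : lqterm V) :
  eval e t \in orbit 'P (LMlt Q) (e (rightmost t)).
Proof.
elim: t => /= [v|t _ u IHu|t _ u IHu]; first exact: orbit_refl.
- by move/orbit_eqP: IHu => <-; apply: lmul_orbit.
(* The dividend is a left translate of the quotient, so symmetry of the orbit relation reduces
   division to multiplication. *)
- move/orbit_eqP: IHu => <-; rewrite orbit_sym.
  by rewrite -{1}[eval e u](lmulVK (eval e t)) lmul_orbit.
Qed.

Lemma malcev_connected (m : lqterm 'I_3) (x0 : Q) :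
  (forall x y : Q, eval3 m x y y = x /\ eval3 m y y x = x) -> connected Q.
Proof.
move=> mP; have same_orbit x y : x \in orbit 'P (LMlt Q) y.
  have [m1 m2] := mP x y; have [m3 m4] := mP y x.
  have := (eval_orbit (tnth [tuple x; y; y]) m,
           eval_orbit (tnth [tuple x; x; y]) m).
  rewrite -/(eval3 m x y y) -/(eval3 m x x y) m1 m4.
  (* If the rightmost variable of [m] is the first, then [y = m(x,x,y)] lies in the orbit of [x]; if
     it is the second or third, then [x = m(x,y,y)] lies in the orbit of [y]. *)
  by case: (rightmost m) => [[|[|[|]]]] //= p [? ?]; rewrite // orbit_sym.
apply/imsetP; exists x0 => //; apply/setP=> y.
by rewrite inE same_orbit.
Qed.

(** In a finite group every element of a generated subgroup is a product of generators without
    inverses, so closure under [lmul] suffices and [ldiv] need not be treated. *)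
Lemma LMlt_ind (P : Q -> Prop) (b : Q) :
  P b -> (forall a c, P c -> P (lmul a c)) ->
  connected Q -> forall c, P c.
Proof.
move=> Pb Pmul conn c.
have [g /gen_prodgP[n [s sL ->]] ->] := atransP2 conn (in_setT b) (in_setT c).
elim: n s sL => [|n IHn] s sL; first by rewrite big_ord0 /= /aperm perm1.
rewrite big_ord_recr /= /aperm permM.
have /imsetP[a _ ->] := sL ord_max.
by rewrite permE; apply/Pmul/IHn.
Qed.

End Orbits.

Lemma val_eval (Q : finLeftQuasigroupType) (S : subalgebra Q) (V : Type)
    (e : V -> subalg_type S) (t : lqterm V) :
  val (eval e t) = eval (fun v => val (e v)) t.
Proof. by elim: t => //= t <- u <-. Qed.

Section GeneratedSubalgebra.
Variables (Q : finLeftQuasigroupType) (A : {set Q}).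

Definition gen_step (X : {set Q}) : {set Q} :=
  A :|: [set lmul x y | x in X, y in X] :|: [set ldiv x y | x in X, y in X].

Lemma gen_step_mono : {homo gen_step : X Y / X \subset Y}.
Proof. by move=> X Y XY; rewrite !setUSS ?imset2S. Qed.

Definition gen_set : {set Q} := fixset gen_step.

Lemma gen_setE : gen_set = gen_step gen_set.
Proof. by rewrite [RHS]fixsetK //; apply: gen_step_mono. Qed.

Lemma sub_gen_set : A \subset gen_set.
Proof. by rewrite gen_setE /gen_step -setUA subsetUl. Qed.

Lemma gen_set_mul x y : x \in gen_set -> y \in gen_set -> lmul x y \in gen_set.
Proof. by move=> xS yS; rewrite gen_setE !inE imset2_f ?orbT. Qed.

Lemma gen_set_div x y : x \in gen_set -> y \in gen_set -> ldiv x y \in gen_set.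
Proof. by move=> xS yS; rewrite gen_setE !inE imset2_f ?orbT. Qed.

(** The least fixed point is the [#|Q|]-fold iterate of [gen_step] from the empty set; the induction
    is on the number of iterations. *)
Lemma gen_set_ind (P : Q -> Prop) :
  (forall x, x \in A -> P x) ->
  (forall x y, P x -> P y -> P (lmul x y)) ->
  (forall x y, P x -> P y -> P (ldiv x y)) ->
  forall x, x \in gen_set -> P x.
Proof.
move=> PA Pmul Pdiv; rewrite /gen_set /fixset.
elim: #|Q| => [|n IHn] x /=; first by rewrite inE.
rewrite !inE -orbA => /or3P[/PA //||] /imset2P[y z /IHn ? /IHn ? ->].
- exact: Pmul.
- exact: Pdiv.
Qed.

End GeneratedSubalgebra.

Section Gluing.
Variable Q : finLeftQuasigroupType.
Hypothesis hQ : idempotent_lq Q.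

Let X : lqterm 'I_3 := TVar (@Ordinal 3 0 isT).
Let Y : lqterm 'I_3 := TVar (@Ordinal 3 1 isT).
Let Z : lqterm 'I_3 := TVar (@Ordinal 3 2 isT).

Let eval3S (m t1 t2 t3 : lqterm 'I_3) (x y z : Q) :
  eval3 (tsubst (tnth [tuple t1; t2; t3]) m) x y z
    = eval3 m (eval3 t1 x y z) (eval3 t2 x y z) (eval3 t3 x y z).
Proof. exact: eval_tsubst_tnth. Qed.

Let eval3X (x y z : Q) : eval3 X x y z = x. Proof. by []. Qed.
Let eval3Y (x y z : Q) : eval3 Y x y z = y. Proof. by []. Qed.
Let eval3Z (x y z : Q) : eval3 Z x y z = z. Proof. by []. Qed.
Let eval3M (t u : lqterm 'I_3) (x y z : Q) :
  eval3 (TMul t u) x y z = lmul (eval3 t x y z) (eval3 u x y z).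
Proof. by []. Qed.
Let eval3D (t u : lqterm 'I_3) (x y z : Q) :
  eval3 (TDiv t u) x y z = ldiv (eval3 t x y z) (eval3 u x y z).
Proof. by []. Qed.
Let eval3E := (eval3S, eval3X, eval3Y, eval3Z, eval3M, eval3D).

Definition half_malcev (p : lqterm 'I_3) : Prop :=
  forall y z : Q, eval3 p y y z = z.

Lemma gen_set2_term (a b c : Q) :
  c \in gen_set [set a; b] -> exists t, eval3 t a b b = c.
Proof.
move: c; apply: gen_set_ind => [c|_ _ [t <-] [u <-]|_ _ [t <-] [u <-]].
- by rewrite !inE => /orP[]/eqP->; [exists X | exists Y].
- by exists (TMul t u).
- by exists (TDiv t u).
Qed.

Lemma half_malcev_at (a b : Q) :
  superconnected Q -> exists2 p, half_malcev p & eval3 p a b b = a.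
Proof.
move=> scQ.
have aS : a \in gen_set [set a; b].
  by rewrite (subsetP (sub_gen_set _)) ?set21.
have bS : b \in gen_set [set a; b].
  by rewrite (subsetP (sub_gen_set _)) ?set22.
have S0 : gen_set [set a; b] != set0 by apply/set0Pn; exists a.
pose S := Subalgebra S0 (@gen_set_mul _ _) (@gen_set_div _ _).
pose b' : subalg_type S := exist _ b bS.
suff: forall c : subalg_type S,
    exists2 p, half_malcev p & eval3 p a b b = val c
  by move/(_ (exist _ a aS)).
(* The walk starts at [b], the value at [(a,b,b)] of the third projection, which is half Mal'cev. *)
apply: (LMlt_ind (b := b')) (scQ S); first by exists Z.
move=> d c [p pP pc]; have [t td] := gen_set2_term (valP d).
(* On [(y,y,z)] the division by [y] cancels the new translation, since
   [t(y,y) = y]; on [(a,b,b)] it does nothing, since [b * b = b]. *)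
exists (TMul (tsubst (tnth [tuple X; Y; Y]) t)
             (tsubst (tnth [tuple X; Y; TDiv Y Z]) p)).
- by move=> y z; rewrite !eval3E pP eval3_idem // lmulVK.
- rewrite !eval3E (_ : ldiv b b = b); first by rewrite td pc.
  by rewrite -{2}[b]hQ lmulK.
Qed.

Lemma half_malcev_on (s : seq (Q * Q)) :
  superconnected Q ->
  exists2 q, half_malcev q & {in s, forall u, eval3 q u.1 u.2 u.2 = u.1}.
Proof.
move=> scQ; elim: s => [|[a b] s [q qP qs]]; first by exists Z.
have [p pP pa] := half_malcev_at a (eval3 q a b b) scQ.
exists (tsubst (tnth [tuple X; tsubst (tnth [tuple X; Y; Y]) q; q]) p).
  by move=> y z; rewrite !eval3E !qP pP.
move=> [c d]; rewrite inE => /orP[/eqP[-> ->]|/qs /= qc] /=; rewrite !eval3E //.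
(* For an earlier pair [q(c,d,d) = c], so the glued term takes the value [p(c,c,c) = c]. *)
by rewrite qc pP.
Qed.

End Gluing.

Theorem corollary3p3 (Q : finLeftQuasigroupType) (hQ : idempotent_lq Q) :
  has_malcev_term (generated_variety Q) <-> superconnected Q.
Proof.
split=> [/has_malcev_termP[m mP] S | scQ].
  have /set0Pn[x0 x0S] := subalg_neq0 S.
  pose s0 : subalg_type S := exist _ x0 x0S.
  apply: (malcev_connected (m := m) s0) => x y.
  have val3 (u v w : subalg_type S) :
      val (eval3 m u v w) = eval3 m (val u) (val v) (val w).
    by rewrite /eval3 val_eval; apply: eq_eval => i; rewrite (tnth3_map val).
  by split; apply: val_inj; rewrite val3; case: (mP (val x) (val y)).
(* Finiteness of [Q] allows gluing over all pairs at once, which turns the local equations into the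
   missing law [m(x,y,y) = x]. *)
have [m m1 m2] := half_malcev_on hQ (enum {: Q * Q}) scQ.
apply/has_malcev_termP; exists m => x y; split; last exact: m1.
by apply: (m2 (x, y)); rewrite mem_enum.
Qed.
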